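(* Let $(G,B,w)$ be a finite weighted graph with boundary $B$ and interior $\Omega=V(G)\setminus B$, and let $k\ge 0$. For $\varphi\in A^k(\partial\Omega)$ let $E^{(k)}_{\delta d}(\varphi)$, $E^{(k)}_{d\delta}(\varphi)$, $E^{(k)}(\varphi)\in A^k(G)$ be solutions $\omega$ of, respectively, $\delta d\omega=0$ in $\Omega$, $d\delta\omega=0$ in $\Omega$, $\Delta\omega=0$ in $\Omega$, each with boundary condition $\omega=\varphi$ on $C_{k+1}(\partial\Omega)$. Then the operators $T^{(k)}_{\delta d},T^{(k)}_{d\delta},T^{(k)}:A^k(\partial\Omega)\to A^k(\partial\Omega)$ given by $$T^{(k)}_{\delta d}(\varphi)=\mathbf{N}(dE^{(k)}_{\delta d}(\varphi)),\qquad T^{(k)}_{d\delta}(\varphi)=\mathbf{D}(\delta E^{(k)}_{d\delta}(\varphi)),\qquad T^{(k)}(\varphi)=\mathbf{N}(dE^{(k)}(\varphi))+\mathbf{D}(\delta E^{(k)}(\varphi))$$ are well defined, i.e. the right-hand sides do not depend on the choice of the solutions $E^{(k)}_{\delta d}(\varphi)$, $E^{(k)}_{d\delta}(\varphi)$, $E^{(k)}(\varphi)$ of the respective boundary value problems.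
   Context: All graphs are simple. $V(G),E(G)$ are the vertex and edge sets. A $k$-clique of $G$ is a set of $k$ distinct pairwise adjacent vertices; $C_k(G)$ is the set of $k$-cliques. A $k$-form on $G$ ($k\ge 0$) is a function $f:V(G)^{k+1}\to\mathbb{R}$ that is skew-symmetric in its variables and satisfies $f(v_0,\dots,v_k)=0$ whenever $\{v_0,\dots,v_k\}\notin C_{k+1}(G)$; $A^k(G)$ is the space of $k$-forms. The exterior differential $d:A^k(G)\to A^{k+1}(G)$ is $d\alpha(v_0,\dots,v_{k+1})=\sum_{j=0}^{k+1}(-1)^j\alpha(v_0,\dots,\hat v_j,\dots,v_{k+1})$ if $\{v_0,\dots,v_{k+1}\}\in C_{k+2}(G)$, and $0$ otherwise. A weight $w$ on $G$ assigns, for every $k\ge0$, to each $(v_0,\dots,v_k)\in V(G)^{k+1}$ a real number $w(v_0,\dots,v_k)$, symmetric in the variables, positive if $\{v_0,\dots,v_k\}\in C_{k+1}(G)$ and $0$ otherwise. For finite $G$, $\langle\alpha,\beta\rangle_G=\frac1{(k+1)!}\sum_{v_0,\dots,v_k\in V(G)}\alpha(v_0,\dots,v_k)\beta(v_0,\dots,v_k)w(v_0,\dots,v_k)$ is the inner product on $A^k(G)$, $\delta:A^{k+1}(G)\to A^k(G)$ is the adjoint of $d$ (with $\delta=0$ on $A^0(G)$), and $\Delta=d\delta+\delta d$. A graph with boundary $(G,B)$ is a simple graph $G$ with $B\subset V(G)$ such that no two vertices of $B$ are adjacent and every vertex of $B$ is adjacent to some vertex of $\Omega:=V(G)\setminus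 B$ (the interior). $C_{k+1}(\partial\Omega)$ is the set of $(k+1)$-cliques of $G$ with exactly one vertex in $B$ and the remaining $k$ vertices in $\Omega$. $A^k(\partial\Omega)$ is the space of functions $f:B\times\Omega^k\to\mathbb{R}$, skew-symmetric in the last $k$ variables, with $f(v_0,\dots,v_k)=0$ when $\{v_0,\dots,v_k\}\notin C_{k+1}(\partial\Omega)$. For a form $\theta\in A^k(G)$, ''$\theta=0$ in $\Omega$'' means that $\theta$ vanishes on every $(k+1)$-clique of $G$ contained in $\Omega$; ''$\omega=\varphi$ on $C_{k+1}(\partial\Omega)$'' means that the restriction of $\omega$ to $B\times\Omega^k$ equals $\varphi$. Solutions of all three boundary value problems exist. For $\alpha\in A^{k+1}(G)$, $\mathbf{N}\alpha\in A^k(\partial\Omega)$ is $\mathbf{N}\alpha(v,v_1,\dots,v_k)=\frac{1}{w(v,v_1,\dots,v_k)}\sum_{u\in\Omega}\alpha(u,v,v_1,\dots,v_k)w(u,v,v_1,\dots,v_k)$, and for $\alpha\in A^{k-1}(G)$ ($k\ge1$), $\mathbf{D}\alpha\in A^k(\partial\Omega)$ is $\mathbf{D}\alpha(v,v_1,\dots,v_k)=\alpha(v_1,\dots,v_k)$, whenever $\{v,v_1,\dots,v_k\}\in C_{k+1}(\partial\Omega)$, $v\in B$ (and $0$ otherwise). For $k=0$ the terms involving $\mathbf{D}\delta$ are zero. *)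

(* Defs.v *)
From HB Require Import structures.
From mathcomp Require Import all_boot all_order all_fingroup all_algebra.
From mathcomp Require Import boolp reals.

Set Implicit Arguments.
Unset Strict Implicit.
Unset Printing Implicit Defensive.

Import Order.TTheory GRing.Theory Num.Theory.
Local Open Scope ring_scope.

Record sgraph := SGraph {
  vertex :> finType;
  adj : rel vertex;
  adj_sym : symmetric adj;
  adj_irr : irreflexive adj }.

Definition cliques (G : sgraph) (k : nat) : {set {set G}} :=
  [set S : {set G} | (#|S| == k) &&
    [forall x in S, forall y in S, (x != y) ==> adj x y]].

Definition tclique (G : sgraph) (n : nat) (t : n.-tuple G) : bool :=
  [set x in t] \in cliques G n.

(* The tuple (t_(f 0), ..., t_(f (m-1))): for a permutation f this permutes the
   variables, and for f = lift j it omits the j-th one. *)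
Definition treindex (T : Type) (m n : nat) (f : 'I_m -> 'I_n) (t : n.-tuple T) :
  m.-tuple T := [tuple tnth t (f i) | i < m].

Lemma treindex_comp (T : Type) m n p (f : 'I_m -> 'I_n) (g : 'I_n -> 'I_p)
    (t : p.-tuple T) :
  treindex f (treindex g t) = treindex (g \o f) t.
Proof. by apply: eq_from_tnth => i; rewrite !tnth_mktuple. Qed.

Lemma eq_treindex (T : Type) m n (f g : 'I_m -> 'I_n) (t : n.-tuple T) :
  f =1 g -> treindex f t = treindex g t.
Proof. by move=> fg; apply: eq_from_tnth => i; rewrite !tnth_mktuple fg. Qed.

Lemma treindex_id (T : Type) n (f : 'I_n -> 'I_n) (t : n.-tuple T) :
  f =1 id -> treindex f t = t.
Proof. by move=> fE; apply: eq_from_tnth => i; rewrite !tnth_mktuple fE. Qed.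

Lemma treindex_map (T T' : Type) m n (f : 'I_m -> 'I_n) (h : T -> T')
    (t : n.-tuple T) :
  map_tuple h (treindex f t) = treindex f (map_tuple h t).
Proof.
by apply: eq_from_tnth => i; rewrite tnth_map !tnth_mktuple tnth_map.
Qed.

Lemma treindex_cons (T : Type) n (s : {perm 'I_n}) (u : T) (t : n.-tuple T) :
  [tuple of u :: treindex s t] =
  treindex (lift_perm ord0 ord0 s) [tuple of u :: t].
Proof.
apply: eq_from_tnth => i; rewrite tnth_mktuple.
case: (unliftP ord0 i) => [j|] ->.
  by rewrite lift_perm_lift !tnthS tnth_mktuple.
by rewrite lift_perm_id !tnth0.
Qed.

Lemma treindex_lift0 (T : Type) n (u : T) (t : n.-tuple T) :
  treindex (lift ord0) [tuple of u :: t] = t.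
Proof. by apply: eq_from_tnth => i; rewrite tnth_mktuple tnthS. Qed.

Lemma set_treindex (T : finType) n (s : {perm 'I_n}) (t : n.-tuple T) :
  [set x in treindex s t] = [set x in t].
Proof.
apply/setP => x; rewrite !inE; apply/tnthP/tnthP => -[i ->].
  by exists (s i); rewrite tnth_mktuple.
by exists (s^-1%g i); rewrite tnth_mktuple permKV.
Qed.

Lemma tclique_treindex (G : sgraph) n (s : {perm 'I_n}) (t : n.-tuple G) :
  tclique (treindex s t) = tclique t.
Proof. by rewrite /tclique set_treindex. Qed.

Lemma perm_lift_fact n (s : {perm 'I_n.+1}) (j : 'I_n.+1) :
  exists s' : {perm 'I_n}, s = lift_perm j (s j) s'.
Proof.
pose f k := odflt k (unlift (s j) (s (lift j k))).
have fP k : lift (s j) (f k) = s (lift j k).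
  rewrite /f; case: unliftP => [k' ->//|/perm_inj/eqP].
  by rewrite eq_sym (negbTE (neq_lift j k)).
have finj : injective f.
  move=> x y exy; apply: (@lift_inj _ j); apply: (@perm_inj _ s).
  by rewrite -!fP exy.
exists (perm finj); apply/permP => i.
case: (unliftP j i) => [k|] ->; last by rewrite lift_perm_id.
by rewrite lift_perm_lift permE fP.
Qed.

Section Forms.
Variables (R : realType) (G : sgraph).
Implicit Types k : nat.

Definition is_form k : {pred {ffun k.+1.-tuple G -> R}} :=
  fun f => [forall t, forall s : 'S_k.+1, f (treindex s t) == (-1) ^+ s * f t]
           && [forall t, ~~ tclique t ==> (f t == 0)].

Arguments is_form k _ : clear implicits.

Lemma is_formP k (f : {ffun k.+1.-tuple G -> R}) :
  reflect ((forall t (s : 'S_k.+1), f (treindex s t) = (-1) ^+ s * f t) /\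
           (forall t, ~~ tclique t -> f t = 0)) (f \in is_form k).
Proof.
apply: (iffP andP) => -[fs f0]; split.
- by move=> t s; have /forallP/(_ t)/forallP/(_ s)/eqP := fs.
- by move=> t tC; apply/eqP; have /forallP/(_ t)/implyP := f0; apply.
- by apply/forallP => t; apply/forallP => s; rewrite fs.
- by apply/forallP => t; apply/implyP => tC; rewrite f0.
Qed.

Lemma is_form_zmod_closed k : zmod_closed (is_form k).
Proof.
split.
  by apply/is_formP; split=> [t s|t _]; rewrite !ffunE ?mulr0.
move=> f g /is_formP[fs f0] /is_formP[gs g0]; apply/is_formP; split.
  by move=> t s; rewrite !ffunE fs gs mulrBr.
by move=> t tC; rewrite !ffunE f0 ?g0 ?subr0.
Qed.

HB.instance Definition _ k :=
  GRing.isZmodClosed.Build {ffun k.+1.-tuple G -> R} (is_form k)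
    (is_form_zmod_closed k).

(* A^k(G) *)
Record kform k := KForm {
  form_val :> {ffun k.+1.-tuple G -> R};
  form_valP : form_val \in is_form k }.

HB.instance Definition _ k := [isSub for @form_val k].
HB.instance Definition _ k := [Choice of kform k by <:].
HB.instance Definition _ k := [SubChoice_isSubZmodule of kform k by <:].

Lemma form_skew k (a : kform k) t (s : 'S_k.+1) :
  a (treindex s t) = (-1) ^+ s * a t.
Proof. by have /is_formP[-> _] := form_valP a. Qed.

Lemma form_supp k (a : kform k) t : ~~ tclique t -> a t = 0.
Proof. by have /is_formP[_] := form_valP a; apply. Qed.

Definition ext_diff_fun k (a : kform k) : {ffun k.+2.-tuple G -> R} :=
  [ffun t => if tclique t
             then \sum_(j < k.+2) (-1) ^+ j * a (treindex (lift j) t)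
             else 0].

Lemma ext_diff_subproof k (a : kform k) : ext_diff_fun a \in is_form k.+1.
Proof.
apply/is_formP; split=> [t s|t tC]; rewrite !ffunE; last by rewrite (negbTE tC).
rewrite tclique_treindex; case: ifP => _; last by rewrite mulr0.
rewrite [in RHS](reindex_inj (@perm_inj _ s)) mulr_sumr.
apply: eq_bigr => j _.
have [s' sE] := perm_lift_fact s j.
have -> : treindex (lift j) (treindex s t) =
          treindex s' (treindex (lift (s j)) t).
  rewrite !treindex_comp; apply: eq_treindex => i /=.
  by rewrite {1}sE lift_perm_lift.
rewrite form_skew {2}sE odd_lift_perm !signr_addb !signr_odd.
rewrite -!mulrA; congr (_ * _).
rewrite [in RHS]mulrCA; congr (_ * _).
by rewrite [in RHS]mulrCA; congr (_ * _); rewrite mulrA -expr2 sqrr_sign mul1r.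
Qed.

Definition ext_diff k (a : kform k) : kform k.+1 := KForm (ext_diff_subproof a).

Record weight := Weight {
  weight_fun :> forall k, k.+1.-tuple G -> R;
  weight_sym : forall k (t : k.+1.-tuple G) (s : 'S_k.+1),
    weight_fun (treindex s t) = weight_fun t;
  weight_gt0 : forall k (t : k.+1.-tuple G), tclique t -> 0 < weight_fun t;
  weight_eq0 : forall k (t : k.+1.-tuple G), ~~ tclique t -> weight_fun t = 0 }.

Section Weighted.
Variable w : weight.

(* <a, b>_G on A^k(G) *)
Definition kinner k (a b : kform k) : R :=
  ((k.+1)`!%:R)^-1 * \sum_(t : k.+1.-tuple G) a t * b t * w k t.

Lemma inner_eq0 k (a : kform k) : kinner a a = 0 -> a = 0.
Proof.
have w_ge0 t : 0 <= w k t.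
  by have [/(weight_gt0 w)/ltW//|/(weight_eq0 w)->] := boolP (tclique t).
move=> /eqP; rewrite mulf_eq0 invr_eq0 pnatr_eq0 eqn0Ngt fact_gt0 /= => /eqP.
move=> /(psumr_eq0P (fun t _ => mulr_ge0 (sqr_ge0 (a t)) (w_ge0 t))) s0.
apply/val_inj/ffunP => t; rewrite ffunE /=.
have [tC|/(form_supp a)//] := boolP (tclique t).
move/eqP: (s0 t isT); rewrite mulf_eq0 (gt_eqF (weight_gt0 w tC)) orbF.
by rewrite sqrf_eq0 => /eqP.
Qed.

Lemma innerBr k (a b c : kform k) : kinner a (b - c) = kinner a b - kinner a c.
Proof.
rewrite /kinner -mulrBr -sumrB; congr (_ * _); apply: eq_bigr => t _.
by rewrite !ffunE mulrBr mulrBl.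
Qed.

(* Explicit formula used only to show that the adjoint of d exists. *)
Definition codiff_witness_fun k (b : kform k.+1) : {ffun k.+1.-tuple G -> R} :=
  [ffun t => if tclique t
    then (w k t)^-1 * \sum_u b [tuple of u :: t] * w k.+1 [tuple of u :: t]
    else 0].

Lemma codiff_witness_subproof k (b : kform k.+1) :
  codiff_witness_fun b \in is_form k.
Proof.
apply/is_formP; split=> [t s|t tC]; rewrite !ffunE; last by rewrite (negbTE tC).
rewrite tclique_treindex; case: ifP => _; last by rewrite mulr0.
rewrite weight_sym mulrCA; congr (_ * _); rewrite mulr_sumr.
apply: eq_bigr => u _.
by rewrite treindex_cons weight_sym form_skew odd_lift_perm /= mulrA.
Qed.

Lemma sum_tuple_cons k (F : k.+1.-tuple G -> R) :
  \sum_t F t = \sum_(t : k.-tuple G) \sum_u F [tuple of u :: t].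
Proof.
rewrite pair_big /=.
rewrite (reindex (fun p : k.-tuple G * G => [tuple of p.2 :: p.1])) //=.
exists (fun t => (behead_tuple t, thead t)) => [[t u] _|t _] /=.
  by congr pair; apply: val_inj.
by rewrite -tuple_eta.
Qed.

Lemma adjoint_exists k : exists del : kform k.+1 -> kform k,
  forall a b, kinner (ext_diff a) b = kinner a (del b).
Proof.
exists (fun b => KForm (codiff_witness_subproof b)) => a b.
pose S := \sum_(t : k.+2.-tuple G) a (treindex (lift ord0) t) * b t * w k.+1 t.
have -> : kinner (ext_diff a) b = ((k.+2)`!%:R)^-1 * \sum_(j < k.+2) S.
  congr (_ * _).
  transitivity (\sum_(t : k.+2.-tuple G) \sum_(j < k.+2)
      (-1) ^+ j * a (treindex (lift j) t) * b t * w k.+1 t).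
    apply: eq_bigr => t _; rewrite ffunE; case: ifPn => tC.
      by rewrite !mulr_suml.
    rewrite mul0r mul0r big1 // => j _.
    by rewrite weight_eq0 ?mulr0.
  rewrite exchange_big; apply: eq_bigr => j _ /=.
  pose s := lift_perm j ord0 1 : 'S_k.+2.
  rewrite (reindex (treindex s)) /=; last first.
    exists (treindex (s^-1)%g) => t _.
      by rewrite treindex_comp treindex_id // => i /=; rewrite permKV.
    by rewrite treindex_comp treindex_id // => i /=; rewrite permK.
  apply: eq_bigr => t _.
  rewrite weight_sym form_skew /s odd_lift_perm odd_perm1 /= !addbF signr_odd.
  rewrite treindex_comp (@eq_treindex _ _ _ _ (lift ord0)); last first.
    by move=> i /=; rewrite lift_perm_lift perm1.
  by rewrite mulrACA -expr2 sqrr_sign mul1r.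
rewrite sumr_const card_ord /kinner factS natrM -[S *+ _]mulr_natl invfM mulrA.
rewrite [(k.+2)%:R^-1 * _]mulrC -[_ * (k.+2)%:R]mulrA mulVf ?pnatr_eq0 // mulr1.
congr (_ * _); rewrite /S sum_tuple_cons; apply: eq_bigr => t _.
rewrite ffunE; case: ifPn => tC; last first.
  rewrite mulr0 mul0r big1 // => u _.
  by rewrite treindex_lift0 form_supp ?mul0r.
rewrite mulrAC -mulrA mulVKf ?gt_eqF ?weight_gt0 //.
rewrite mulr_sumr; apply: eq_bigr => u _.
by rewrite treindex_lift0 mulrA.
Qed.

(* delta, the adjoint of d; it is unique by codiff_unique. *)
Definition codiff k : kform k.+1 -> kform k := projT1 (cid (adjoint_exists k)).

Lemma codiff_adjoint k (a : kform k) (b : kform k.+1) :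
  kinner (ext_diff a) b = kinner a (codiff b).
Proof. by rewrite /codiff; case: cid. Qed.

Lemma codiff_unique k (del : kform k.+1 -> kform k) :
  (forall a b, kinner (ext_diff a) b = kinner a (del b)) -> del =1 @codiff k.
Proof.
move=> delP b; apply/eqP; rewrite -subr_eq0; apply/eqP/inner_eq0.
by rewrite innerBr -delP -codiff_adjoint subrr.
Qed.

(* d delta, with delta = 0 on A^0(G) *)
Definition diff_codiff k : kform k -> kform k :=
  match k with
  | 0 => fun=> 0
  | k'.+1 => fun a => ext_diff (codiff a)
  end.

Definition codiff_diff k (a : kform k) : kform k := codiff (ext_diff a).

Definition laplacian k (a : kform k) : kform k := diff_codiff a + codiff_diff a.

End Weighted.

Variable B : {set G}.

Definition graph_with_boundary : Prop :=
  (forall x y, x \in B -> y \in B -> ~~ adj x y) /\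
  (forall x, x \in B -> exists2 y, y \in ~: B & adj x y).

(* C_k(boundary Omega) *)
Definition bcliques k : {set {set G}} :=
  [set S in cliques G k | #|S :&: B| == 1%N].

(* The domain B x Omega^k of the elements of A^k(boundary Omega) *)
Definition bvertex : finType := {x : G | x \in B}.
Definition ivertex : finType := {x : G | x \in ~: B}.
Definition bdom k : finType := (bvertex * k.-tuple ivertex)%type.

Definition itup k (t : k.-tuple ivertex) : k.-tuple G := map_tuple val t.
Definition btup k (p : bdom k) : k.+1.-tuple G :=
  [tuple of val p.1 :: itup p.2].

Definition btclique k (p : bdom k) : bool := [set x in btup p] \in bcliques k.+1.

Definition is_bform k : {pred {ffun bdom k -> R}} :=
  fun f => [forall v, forall t, forall s : 'S_k,
              f (v, treindex s t) == (-1) ^+ s * f (v, t)]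
           && [forall p, ~~ btclique p ==> (f p == 0)].

Arguments is_bform k _ : clear implicits.

Lemma is_bformP k (f : {ffun bdom k -> R}) :
  reflect ((forall v t (s : 'S_k),
              f (v, treindex s t) = (-1) ^+ s * f (v, t)) /\
           (forall p, ~~ btclique p -> f p = 0)) (f \in is_bform k).
Proof.
apply: (iffP andP) => -[fs f0]; split.
- by move=> v t s; have /forallP/(_ v)/forallP/(_ t)/forallP/(_ s)/eqP := fs.
- by move=> t tC; apply/eqP; have /forallP/(_ t)/implyP := f0; apply.
- apply/forallP => v; apply/forallP => t; apply/forallP => s.
  by rewrite fs.
- by apply/forallP => t; apply/implyP => tC; rewrite f0.
Qed.

Lemma is_bform_zmod_closed k : zmod_closed (is_bform k).
Proof.
split.
  by apply/is_bformP; split=> [v t s|t _]; rewrite !ffunE ?mulr0.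
move=> f g /is_bformP[fs f0] /is_bformP[gs g0]; apply/is_bformP; split.
  by move=> v t s; rewrite !ffunE fs gs mulrBr.
by move=> t tC; rewrite !ffunE f0 ?g0 ?subr0.
Qed.

HB.instance Definition _ k :=
  GRing.isZmodClosed.Build {ffun bdom k -> R} (is_bform k)
    (is_bform_zmod_closed k).

(* A^k(boundary Omega) *)
Record bkform k := BKForm {
  bform_val :> {ffun bdom k -> R};
  bform_valP : bform_val \in is_bform k }.

HB.instance Definition _ k := [isSub for @bform_val k].
HB.instance Definition _ k := [Choice of bkform k by <:].
HB.instance Definition _ k := [SubChoice_isSubZmodule of bkform k by <:].

Lemma btup_treindex k v (t : k.-tuple ivertex) (s : 'S_k) :
  btup (v, treindex s t) = treindex (lift_perm ord0 ord0 s) (btup (v, t)).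
Proof.
rewrite -treindex_cons -[treindex s (itup _)]treindex_map.
exact: val_inj.
Qed.

Lemma btclique_treindex k v (t : k.-tuple ivertex) (s : 'S_k) :
  btclique (v, treindex s t) = btclique (v, t).
Proof. by rewrite /btclique btup_treindex set_treindex. Qed.

Definition normal_fun (w : weight) k (a : kform k.+1) : {ffun bdom k -> R} :=
  [ffun p => if btclique p
    then (w k (btup p))^-1 * \sum_(u in ~: B)
           a [tuple of u :: btup p] * w k.+1 [tuple of u :: btup p]
    else 0].

Lemma normal_subproof w k (a : kform k.+1) : normal_fun w a \in is_bform k.
Proof.
apply/is_bformP; split=> [v t s|p pC]; rewrite !ffunE; last by rewrite (negbTE pC).
rewrite btclique_treindex; case: ifP => _; last by rewrite mulr0.
rewrite btup_treindex weight_sym mulrCA; congr (_ * _); rewrite mulr_sumr.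
apply: eq_bigr => u _.
by rewrite treindex_cons weight_sym form_skew !odd_lift_perm /= mulrA.
Qed.

(* The operator N *)
Definition bdry_normal w k (a : kform k.+1) : bkform k := BKForm (normal_subproof w a).

Definition dirichlet_fun k (a : kform k) : {ffun bdom k.+1 -> R} :=
  [ffun p => if btclique p then a (itup p.2) else 0].

Lemma dirichlet_subproof k (a : kform k) : dirichlet_fun a \in is_bform k.+1.
Proof.
apply/is_bformP; split=> [v t s|p pC]; rewrite !ffunE; last by rewrite (negbTE pC).
rewrite btclique_treindex; case: ifP => _; last by rewrite mulr0.
by rewrite [itup _]treindex_map form_skew.
Qed.

(* The operator D *)
Definition bdry_dirichlet k (a : kform k) : bkform k.+1 := BKForm (dirichlet_subproof a).

(* D delta, read as zero on 0-forms *)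
Definition bdry_dirichlet_codiff (w : weight) k : kform k -> bkform k :=
  match k with
  | 0 => fun=> 0
  | k'.+1 => fun a => bdry_dirichlet (codiff w a)
  end.

Definition vanishes_in_interior k (a : kform k) : Prop :=
  forall t : k.+1.-tuple G, tclique t -> [set x in t] \subset ~: B -> a t = 0.

Definition agrees_on_boundary k (a : kform k) (phi : bkform k) : Prop :=
  forall p : bdom k, a (btup p) = phi p.

Definition solves k (L : kform k -> kform k) (phi : bkform k) (a : kform k) : Prop :=
  vanishes_in_interior (L a) /\ agrees_on_boundary a phi.

End Forms.

Arguments solves {R G} B {k} L phi a.
Arguments bdry_normal {R G} B w {k} a.
Arguments bdry_dirichlet {R G} B {k} a.
Arguments bdry_dirichlet_codiff {R G} B w {k} a.
Arguments diff_codiff {R G} w {k} a.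
Arguments codiff_diff {R G} w {k} a.
Arguments laplacian {R G} w {k} a.

(* Main.v *)
(** The difference [e] of two solutions of one boundary value problem vanishes
    on every clique meeting [B], because [B] is independent, while [L e] vanishes
    on the cliques inside [Omega].  Hence [<e, L e> = 0]; as [<e, delta d e>] and
    [<e, d delta e>] are the squared norms of [d e] and [delta e], the relevant
    ones among [d e] and [delta e] vanish. *)
Require Import Defs.
From mathcomp Require Import all_boot all_order all_fingroup all_algebra.
From mathcomp Require Import boolp reals.

Set Implicit Arguments.
Unset Strict Implicit.
Unset Printing Implicit Defensive.

Import Order.TTheory GRing.Theory Num.Theory.
Local Open Scope ring_scope.

Section Cliques.
Variable G : sgraph.

(** The set of entries has as many elements as the tuple has positions, which leaves no room for a
    repetition. *)
Lemma tclique_uniq n (t : n.-tuple G) : tclique t -> uniq t.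
Proof.
rewrite /tclique inE => /andP[/eqP tn _]; apply/card_uniqP.
by rewrite size_tuple -[RHS]tn; apply: eq_card => x; rewrite inE.
Qed.

Lemma tclique_adj n (t : n.-tuple G) (i j : 'I_n) :
  tclique t -> i != j -> adj (tnth t i) (tnth t j).
Proof.
move=> tC ij; have /tuple_uniqP tinj := tclique_uniq tC.
move: tC; rewrite /tclique inE => /andP[_ /forall_inP tadj].
have /tadj/forall_inP/(_ (tnth t j)) : tnth t i \in [set x in t].
  by rewrite inE mem_tnth.
by rewrite inE mem_tnth (inj_eq tinj) => /(_ isT)/implyP; apply.
Qed.

End Cliques.

Section Forms.
Variables (R : realType) (G : sgraph) (w : weight R G).

Lemma ext_diffB k (a b : kform R G k) :
  ext_diff (a - b) = ext_diff a - ext_diff b.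
Proof.
apply/val_inj/ffunP => t; rewrite !ffunE /=.
case: ifP => _; last by rewrite subr0.
by rewrite -sumrB; apply: eq_bigr => j _; rewrite !ffunE mulrBr.
Qed.

Lemma kinnerC k (a b : kform R G k) : kinner w a b = kinner w b a.
Proof.
by congr (_ * _); apply: eq_bigr => t _; rewrite [a t * b t]mulrC.
Qed.

Lemma kinnerDr k (a b c : kform R G k) :
  kinner w a (b + c) = kinner w a b + kinner w a c.
Proof.
rewrite /kinner -mulrDr -big_split; congr (_ * _); apply: eq_bigr => t _.
by rewrite !ffunE mulrDr mulrDl.
Qed.

Lemma kinner_ge0 k (a : kform R G k) : 0 <= kinner w a a.
Proof.
rewrite mulr_ge0 ?invr_ge0 ?ler0n// sumr_ge0 // => t _.
have [/(weight_gt0 w)/ltW w0|/(weight_eq0 w)->] := boolP (tclique t).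
  by rewrite mulr_ge0 // sqr_ge0.
by rewrite mulr0.
Qed.

(** [codiff] is a chosen adjoint, so its additivity comes from definiteness: by adjointness the
    defect pairs to zero with every form, in particular with itself. *)
Lemma codiffB k (a b : kform R G k.+1) :
  codiff w (a - b) = codiff w a - codiff w b.
Proof.
apply/eqP; rewrite -subr_eq0; apply/eqP/(@inner_eq0 _ _ w).
by rewrite !innerBr -!codiff_adjoint innerBr subrr.
Qed.

Lemma codiff_diffB k (a b : kform R G k) :
  codiff_diff w (a - b) = codiff_diff w a - codiff_diff w b.
Proof. by rewrite /codiff_diff ext_diffB codiffB. Qed.

Lemma diff_codiffB k (a b : kform R G k) :
  diff_codiff w (a - b) = diff_codiff w a - diff_codiff w b.
Proof.
by case: k a b => [|k] a b /=; rewrite ?subr0 // codiffB ext_diffB.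
Qed.

Lemma laplacianB k (a b : kform R G k) :
  laplacian w (a - b) = laplacian w a - laplacian w b.
Proof. by rewrite /laplacian diff_codiffB codiff_diffB addrACA opprD. Qed.

Lemma kinner_codiff_diff k (a : kform R G k) :
  kinner w a (codiff_diff w a) = kinner w (ext_diff a) (ext_diff a).
Proof. by rewrite -codiff_adjoint. Qed.

Lemma kinner_diff_codiff k (a : kform R G k.+1) :
  kinner w a (diff_codiff w a) = kinner w (codiff w a) (codiff w a).
Proof. by rewrite kinnerC codiff_adjoint. Qed.

(** In degree 0 the operator is zero by convention; in higher degrees the pairing is the squared
    norm of [codiff w a]. *)
Lemma kinner_diff_codiff_ge0 k (a : kform R G k) :
  0 <= kinner w a (diff_codiff w a).
Proof.
case: k a => [|k] a; last by rewrite kinner_diff_codiff kinner_ge0.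
by rewrite /kinner big1 ?mulr0 // => t _; rewrite ffunE mulr0 mul0r.
Qed.

Lemma ext_diff_eq k (E E' : kform R G k) :
  kinner w (E - E') (codiff_diff w (E - E')) = 0 -> ext_diff E = ext_diff E'.
Proof.
rewrite kinner_codiff_diff => /inner_eq0/eqP.
by rewrite ext_diffB subr_eq0 => /eqP.
Qed.

(** In degree 0 both sides are zero by definition; otherwise the hypothesis says that
    [codiff w (E - E')] has norm zero. *)
Lemma bdry_dirichlet_codiff_eq (B : {set G}) k (E E' : kform R G k) :
  kinner w (E - E') (diff_codiff w (E - E')) = 0 ->
  bdry_dirichlet_codiff B w E = bdry_dirichlet_codiff B w E'.
Proof.
case: k E E' => [|k] E E' //; rewrite kinner_diff_codiff => /inner_eq0/eqP.
by rewrite codiffB subr_eq0 /= => /eqP->.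
Qed.

Section Boundary.
Variables (B : {set G}) (hB : graph_with_boundary B).

(** Up to a sign, the variables can be permuted so that the boundary vertex comes first, and the
    value is then one prescribed on [bdom B k]. *)
Lemma form_boundary_eq0 k (a : kform R G k) (t : k.+1.-tuple G) :
  (forall p : bdom B k, a (btup p) = 0) -> ~~ ([set x in t] \subset ~: B) ->
  a t = 0.
Proof.
move=> a0 /subsetPn[x]; rewrite !inE negbK => /tnthP[i ->] tiB.
have [tC|/(form_supp a)//] := boolP (tclique t).
(* The transposition moves the entry lying in [B] to the front. *)
pose s := tperm ord0 i; pose t' := treindex s t.
have t'0 : tnth t' ord0 = tnth t i by rewrite tnth_mktuple tpermL.
have t'B : tnth t' ord0 \in B by rewrite t'0.
(* A second entry in [B] would be adjacent to the first one, as both lie in one clique. *)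
have t'I j : tnth t' (lift ord0 j) \in ~: B.
  rewrite inE; apply/negP => t'jB; have [/(_ _ _ t'B t'jB)/negP Bind _] := hB.
  by apply: Bind; apply: tclique_adj; rewrite ?tclique_treindex ?neq_lift.
pose v : bvertex B := exist (fun y => y \in B) _ t'B.
pose u j : ivertex B := exist (fun y => y \in ~: B) _ (t'I j).
have := a0 (v, [tuple u j | j < k]).
have -> : btup (v, [tuple u j | j < k]) = t'.
  apply: eq_from_tnth => j; case: (unliftP ord0 j) => [l|] ->.
    by rewrite tnthS tnth_map tnth_mktuple.
  by rewrite tnth0.
by rewrite form_skew => /eqP; rewrite mulf_eq0 signr_eq0 /= => /eqP.
Qed.

Lemma kinner_boundary_eq0 k (a b : kform R G k) :
  (forall p : bdom B k, a (btup p) = 0) -> vanishes_in_interior B b ->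
  kinner w a b = 0.
Proof.
move=> a0 b0; rewrite /kinner big1 ?mulr0 // => t _.
have [tI|/(form_boundary_eq0 a0)->] := boolP ([set x in t] \subset ~: B);
  last by rewrite !mul0r.
have [tC|/(form_supp a)->] := boolP (tclique t); last by rewrite !mul0r.
by rewrite b0 // mulr0 mul0r.
Qed.

(** Keeping [L] abstract serves all three boundary value problems at once: subtractivity alone makes
    [L (E - E')] vanish in the interior. *)
Lemma solves_kinner_eq0 k (L : kform R G k -> kform R G k) (phi : bkform R B k)
    (E E' : kform R G k) :
  {morph L : a b / a - b} -> solves B L phi E -> solves B L phi E' ->
  kinner w (E - E') (L (E - E')) = 0.
Proof.
move=> LB [LE Ephi] [LE' E'phi]; apply: kinner_boundary_eq0 => [p|t tC tI].
  by rewrite !ffunE /= Ephi E'phi subrr.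
by rewrite LB !ffunE /= LE // LE' // subrr.
Qed.

End Boundary.

End Forms.

Theorem theorem3p2 (R : realType) (G : sgraph) (B : {set G}) (w : weight R G)
    (k : nat) (hB : graph_with_boundary B) :
  [/\ forall (phi : bkform R B k) (E E' : kform R G k),
        solves B (codiff_diff w) phi E -> solves B (codiff_diff w) phi E' ->
        bdry_normal B w (ext_diff E) = bdry_normal B w (ext_diff E'),
      forall (phi : bkform R B k) (E E' : kform R G k),
        solves B (diff_codiff w) phi E -> solves B (diff_codiff w) phi E' ->
        bdry_dirichlet_codiff B w E = bdry_dirichlet_codiff B w E'
    & forall (phi : bkform R B k) (E E' : kform R G k),
        solves B (laplacian w) phi E -> solves B (laplacian w) phi E' ->
        bdry_normal B w (ext_diff E) + bdry_dirichlet_codiff B w E =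
        bdry_normal B w (ext_diff E') + bdry_dirichlet_codiff B w E'].
Proof.
split=> phi E E' hE hE'.
- congr bdry_normal; apply: (@ext_diff_eq _ _ w).
  exact: (solves_kinner_eq0 w hB (@codiff_diffB _ _ w k) hE hE').
- apply: (@bdry_dirichlet_codiff_eq _ _ w).
  exact: (solves_kinner_eq0 w hB (@diff_codiffB _ _ w k) hE hE').
have /eqP := solves_kinner_eq0 w hB (@laplacianB _ _ w k) hE hE'.
(* For the Laplacian the pairing is a sum of two nonnegative terms, so each is zero and both
   previous arguments apply. *)
rewrite kinnerDr paddr_eq0 ?kinner_diff_codiff_ge0 //; last first.
  by rewrite kinner_codiff_diff kinner_ge0.
case/andP => /eqP dc0 /eqP cd0.
by rewrite (ext_diff_eq cd0) (bdry_dirichlet_codiff_eq B dc0).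
Qed.
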